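(* Let $\mathcal{A}$ be a unital $C^*$-algebra, $\mathcal{H}$ a Hilbert $\mathcal{A}$-module, $K\in End_{\mathcal{A}}^{*}(\mathcal{H})$, and $\mathbb{J}\subseteq\mathbb{N}$ a finite or countable index set. Let $\{T_i\}_{i\in\mathbb{J}}$ be a $K$-operator frame for $End_{\mathcal{A}}^{*}(\mathcal{H})$ with bounds $A$ and $B$, and let $\{R_i\}_{i\in\mathbb{J}}\subset End_{\mathcal{A}}^{*}(\mathcal{H})$. If there exists a constant $M>0$ such that for all $x\in\mathcal{H}$ $$\Big\|\sum_{i\in\mathbb{J}}\langle(T_i-R_i)x,(T_i-R_i)x\rangle\Big\|\le M\min\Big(\Big\|\sum_{i\in\mathbb{J}}\langle T_ix,T_ix\rangle\Big\|,\Big\|\sum_{i\in\mathbb{J}}\langle R_ix,R_ix\rangle\Big\|\Big),$$ then $\{R_i\}_{i\in\mathbb{J}}$ is a $K$-operator frame for $End_{\mathcal{A}}^{*}(\mathcal{H})$. The converse holds if $K$ is a co-isometry: in that case, if $\{R_i\}_{i\in\mathbb{J}}$ is a $K$-operator frame for $End_{\mathcal{A}}^{*}(\mathcal{H})$, then there exists a constant $M>0$ such that the displayed inequality holds for all $x\in\mathcal{H}$.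
   Context: Hilbert $\mathcal{A}$-modules are left modules with $\mathcal{A}$-valued inner product $\langle\cdot,\cdot\rangle$, $\mathcal{A}$-linear in the first variable, with $\langle x,y\rangle=\langle y,x\rangle^*$, complete for $\|x\|=\|\langle x,x\rangle\|^{1/2}$. $End_{\mathcal{A}}^{*}(\mathcal{H})$ is the set of adjointable operators on $\mathcal{H}$. Inequalities between elements of $\mathcal{A}$ refer to the usual order given by the positive cone of $\mathcal{A}$. For $K\in End_{\mathcal{A}}^{*}(\mathcal{H})$, a family $\{T_i\}_{i\in\mathbb{J}}\subset End_{\mathcal{A}}^{*}(\mathcal{H})$ is a $K$-operator frame for $End_{\mathcal{A}}^{*}(\mathcal{H})$ with (lower and upper) bounds $A,B>0$ if $A\langle K^*x,K^*x\rangle\le\sum_{i\in\mathbb{J}}\langle T_ix,T_ix\rangle\le B\langle x,x\rangle$ for all $x\in\mathcal{H}$; it is a $K$-operator frame if such constants exist. $K$ is a co-isometry if $\|K^*x\|=\|x\|$ for all $x\in\mathcal{H}$. Convention: all series of the form $\sum_{i\in\mathbb{J}}\langle T_ix,T_ix\rangle$ are taken to converge in norm in $\mathcal{A}$ (i.e. $\{T_ix\}_i\in\ell^2(\mathcal{H})$, the Hilbert $\mathcal{A}$-module of sequences $\{x_i\}$ in $\mathcal{H}$ with $\sum_i\langle x_i,x_i\rangle$ norm convergent); this convergence is part of the notion of $K$-operator frame, and an inequality involving such series includes the assertion that the series appearing in it converge in norm. *)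

(* Defs.v *)
From HB Require Import structures.
From mathcomp Require Import all_boot all_order all_algebra.
From mathcomp Require Import complex.
From mathcomp Require Import boolp classical_sets reals.
From mathcomp Require Import topology normedtype sequences.

Set Implicit Arguments.
Unset Strict Implicit.
Unset Printing Implicit Defensive.

Import Order.TTheory GRing.Theory Num.Theory.
Import numFieldNormedType.Exports.

Local Open Scope classical_set_scope.
Local Open Scope complex_scope.
Local Open Scope ring_scope.

Section NormConvergence.
Variables (R : realType) (V : zmodType) (nu : V -> R).
Implicit Types (u : nat -> V) (l : V).

Definition norm_cvg u l : Prop := (fun n => nu (u n - l)) @ \oo --> (0 : R).

Definition norm_cauchy u : Prop :=
  forall e : R, 0 < e -> exists N : nat,
    forall m n : nat, (N <= m)%N -> (N <= n)%N -> nu (u m - u n) < e.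

Definition norm_complete : Prop :=
  forall u, norm_cauchy u -> exists l, norm_cvg u l.

End NormConvergence.

(* The norm is an operation of the C*-algebra rather than an inherited
   normedModType R[i] structure: Hierarchy-Builder rejects a class below both
   a ring and a normed Z-module that is not a numDomainType. *)
HB.mixin Record isCStarAlgebra (R : realType) A of GRing.Algebra R[i] A := {
  cnorm : A -> R ;
  cnorm0_eq0 : forall a : A, cnorm a = 0 -> a = 0 ;
  cnormZ : forall (k : R[i]) (a : A), cnorm (k *: a) = complex.Re `|k| * cnorm a ;
  cnormD_le : forall a b : A, cnorm (a + b) <= cnorm a + cnorm b ;
  cnormM_le : forall a b : A, cnorm (a * b) <= cnorm a * cnorm b ;
  cnorm_complete : norm_complete cnorm ;
  star : A -> A ;
  starD : forall a b : A, star (a + b) = star a + star b ;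
  starZ : forall (k : R[i]) (a : A), star (k *: a) = Num.conj k *: star a ;
  starM : forall a b : A, star (a * b) = star b * star a ;
  starK : forall a : A, star (star a) = a ;
  cnorm_star_mul : forall a : A, cnorm (star a * a) = cnorm a ^+ 2
}.

#[short(type="cstarAlgType")]
HB.structure Definition CStarAlgebra (R : realType) :=
  { A of isCStarAlgebra R A & GRing.Algebra R[i] A }.

Section PositiveCone.
Variables (R : realType) (A : cstarAlgType R).
Implicit Types a b : A.

Definition spectrum a : set R[i] :=
  [set k | ~ exists b, b * (k%:A - a) = 1 /\ (k%:A - a) * b = 1].

(* In the order of R[i], 0 <= k means that k is a nonnegative real. *)
Definition cpos a : Prop :=
  star a = a /\ forall k, spectrum a k -> 0 <= k.

Definition cle a b : Prop := cpos (b - a).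

End PositiveCone.

(* The complex vector space structure of H is the one given by the action of
   the scalars k%:A of A, with which the A-action and dot are compatible. *)
HB.mixin Record hasDot (R : realType) (A : cstarAlgType R) H
    of GRing.Lmodule A H := {
  dot : H -> H -> A ;
  dotDl : forall x y z : H, dot (x + y) z = dot x z + dot y z ;
  dotZl : forall (a : A) (x y : H), dot (a *: x) y = a * dot x y ;
  dot_star : forall x y : H, dot x y = star (dot y x) ;
  dot_ge0 : forall x : H, cpos (dot x x) ;
  dot_eq0 : forall x : H, dot x x = 0 -> x = 0 ;
  dot_complete : norm_complete (fun x : H => Num.sqrt (cnorm (dot x x)))
}.

#[short(type="hilbertModType")]
HB.structure Definition HilbertModule (R : realType) (A : cstarAlgType R) :=
  { H of hasDot R A H & GRing.Lmodule A H }.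

Definition hnorm (R : realType) (A : cstarAlgType R) (H : hilbertModType A)
  (x : H) : R := Num.sqrt (cnorm (dot x x)).

(* Linearity and boundedness of both maps, and uniqueness of the adjoint,
   follow from the adjunction identity. *)
Record adjointable (R : realType) (A : cstarAlgType R)
    (H : hilbertModType A) := Adjointable {
  opfun :> H -> H ;
  adj : H -> H ;
  adjP : forall x y, dot (opfun x) y = dot x (adj y)
}.

Section OperatorFrames.
Variables (R : realType) (A : cstarAlgType R) (H : hilbertModType A).
Implicit Types (J : set nat) (f : nat -> H -> H) (K : adjointable H).
Implicit Types (T S : nat -> adjointable H).

(* s is the norm-convergent sum over i in J of the <f_i x, f_i x>; maps of
   index outside J are ignored, so that a family over J is represented by a
   sequence. *)
Definition frame_sum J f (x : H) (s : A) : Prop :=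
  norm_cvg (@cnorm R A)
    (fun n => \sum_(0 <= i < n | i \in J) dot (f i x) (f i x)) s.

Definition frame_bounds K J T (a b : R) : Prop :=
  [/\ 0 < a, 0 < b & forall x : H,
    exists s : A, [/\ frame_sum J T x s,
      cle (a%:C *: dot (adj K x) (adj K x)) s & cle s (b%:C *: dot x x)]].

Definition is_frame K J T : Prop := exists a b, frame_bounds K J T a b.

Definition coisometry K : Prop := forall x : H, hnorm (adj K x) = hnorm x.

Definition close_frames J T S (M : R) : Prop :=
  forall x : H, exists d t s : A,
    [/\ frame_sum J (fun i y => T i y - S i y) x d,
        frame_sum J T x t,
        frame_sum J S x s
      & cnorm d <= M * Num.min (cnorm t) (cnorm s)].

End OperatorFrames.

(* Main.v *)
(* The sums of two families and of their difference are related in the order of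
   A by the parallelogram inequality s(f - g) <= 2 (s(f) + s(g)), so closeness of
   the frames amounts to comparing the norms of their sums.  What remains is that
   a norm inequality |p x| <= C |q x| between A-homogeneous positive forms implies
   p x <= C (q x) (Paschke): apply it at h x, where h is the inverse of a square
   root of q x + e, and let e tend to 0.

   The needed facts on positive elements, defined here through the spectrum, come
   from the characterization |t - a| <= t of positivity for self-adjoint a with
   |a| <= t.  It rests on the fact that |a| or -|a| is in the spectrum of a
   self-adjoint a, proved without function theory: if |b| = 1 and
   (1 - b^2) w = 1, then 2^k = 2^k |b^(2^k - 1)| <= |(1 - b^(2^(k+1))) w| <= 2 |w|
   for all k. *)
Require Import Defs.
From mathcomp Require Import all_boot all_order all_algebra.
From mathcomp Require Import complex.
From mathcomp Require Import boolp classical_sets reals.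
From mathcomp Require Import topology normedtype sequences.
From mathcomp Require Import lra.
Set Implicit Arguments.
Unset Strict Implicit.
Unset Printing Implicit Defensive.
Import Order.TTheory GRing.Theory Num.Theory.
Import numFieldNormedType.Exports.
Local Open Scope ring_scope.

(** * Norm convergence in epsilon form *)

Section Convergence.
Local Open Scope classical_set_scope.
Variables (R : realType) (V : zmodType) (nu : V -> R).
Hypothesis nu_ge0 : forall x, 0 <= nu x.

Lemma norm_cvgP (u : nat -> V) (l : V) :
  norm_cvg nu u l <-> forall e : R, 0 < e ->
    exists N : nat, forall n, (N <= n)%N -> nu (u n - l) < e.
Proof.
split.
  move/cvgrPdist_lt => h e /h [N _ hN]; exists N => n /hN /=.
  by rewrite sub0r normrN ger0_norm.
move=> h; apply/cvgrPdist_lt => e /h [N hN]; exists N => // n /hN /=.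
by rewrite sub0r normrN ger0_norm.
Qed.

End Convergence.

(** * Norm and involution of a C*-algebra *)

Section CStarNorm.
Local Open Scope complex_scope.
Variables (R : realType) (A : cstarAlgType R).
Implicit Types (a b c x y z : A) (r t : R).

Lemma cnormZr r a : cnorm (r%:C *: a) = `|r| * cnorm a.
Proof. by rewrite cnormZ normc_def /= expr0n /= addr0 sqrtr_sqr. Qed.

Lemma cnormN a : cnorm (- a) = cnorm a.
Proof. by rewrite -scaleN1r cnormZ normrN normr1 mul1r. Qed.

Lemma cnormi a : cnorm ('i *: a) = cnorm a.
Proof. by rewrite cnormZ normc_def /= expr0n expr1n add0r sqrtr1 mul1r. Qed.

Lemma cnorm0 : cnorm (0 : A) = 0.
Proof. by have := cnormZ 0 (0 : A); rewrite normr0 mul0r scale0r. Qed.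

Lemma cnorm_ge0 a : 0 <= cnorm a.
Proof.
have := cnormD_le a (- a); rewrite subrr cnorm0 cnormN; lra.
Qed.

Lemma cnormB_le a b : cnorm (a - b) <= cnorm a + cnorm b.
Proof. by rewrite -(cnormN b) cnormD_le. Qed.

Lemma cdistC a b : cnorm (a - b) = cnorm (b - a).
Proof. by rewrite -cnormN opprB. Qed.

Lemma cnorm_sub_le a b : cnorm a - cnorm b <= cnorm (a - b).
Proof. by have := cnormD_le (a - b) b; rewrite subrK; lra. Qed.

Lemma star0 : star (0 : A) = 0.
Proof. by have := starZ 0 (0 : A); rewrite rmorph0 !scale0r. Qed.

Lemma starN a : star (- a) = - star a.
Proof. by rewrite -scaleN1r starZ rmorphN rmorph1 scaleN1r. Qed.

Lemma starB a b : star (a - b) = star a - star b.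
Proof. by rewrite starD starN. Qed.

Lemma star1 : star (1 : A) = 1.
Proof. by rewrite -[LHS]mulr1 -[X in _ * X]starK -starM mulr1 starK. Qed.

Lemma starZr r a : star (r%:C *: a) = r%:C *: star a.
Proof. by rewrite starZ; congr (_ *: _); rewrite -[RHS]conjc_real. Qed.

Lemma stari a : star ('i *: a) = - ('i *: star a).
Proof.
rewrite starZ -scaleNr; congr (_ *: _).
by apply/eqP; rewrite eq_complex /= oppr0 !eqxx.
Qed.

(** The C*-identity gives |b|^2 <= |[star b]| |b|, hence |b| <= |[star b]|; the other inequality is
    this one at [star b]. *)
Lemma cnorm_star a : cnorm (star a) = cnorm a.
Proof.
have le b : cnorm b <= cnorm (star b).
  have [->|b0] := eqVneq b 0; first by rewrite star0.
  have : 0 < cnorm b.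
    rewrite lt_def cnorm_ge0 andbT; apply: contra b0 => /eqP/cnorm0_eq0 ->//.
  have := cnormM_le (star b) b; rewrite cnorm_star_mul expr2 => h p.
  by rewrite -(ler_pM2r p).
by apply/eqP; rewrite eq_le le andbT -{2}(starK a) le.
Qed.

Lemma cnorm1 : cnorm (1 : A) = 1.
Proof.
have := cnorm_star_mul (1 : A); rewrite star1 mulr1 expr2.
have n0 : cnorm (1 : A) != 0.
  by apply/eqP => /cnorm0_eq0 /eqP; rewrite oner_eq0.
by move/eqP; rewrite -{1}(mulr1 (cnorm 1)) (inj_eq (mulfI n0)) => /eqP.
Qed.

Lemma cnorm_alg r : cnorm (r%:C%:A : A) = `|r|.
Proof. by rewrite cnormZr cnorm1 mulr1. Qed.

Lemma star_alg r : star (r%:C%:A : A) = r%:C%:A.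
Proof. by rewrite starZr star1. Qed.

Lemma cnorm_sqr_sa a : star a = a -> cnorm (a * a) = cnorm a ^+ 2.
Proof. by move=> sa; rewrite -cnorm_star_mul sa. Qed.

Lemma star_exp a n : star a = a -> star (a ^+ n) = a ^+ n.
Proof.
move=> sa; elim: n => [|n IH]; rewrite ?star1 //.
by rewrite [in LHS]exprS starM IH sa -exprSr.
Qed.

Lemma cnorm_exp2n a k : star a = a -> cnorm (a ^+ (2 ^ k)) = cnorm a ^+ (2 ^ k).
Proof.
move=> sa; elim: k => [|k IH] //.
by rewrite expnSr !exprM expr2 cnorm_sqr_sa ?IH // star_exp.
Qed.

End CStarNorm.

(** * Limits in the algebra and Banach's fixed point theorem *)

Section CStarLimits.
Local Open Scope complex_scope.
Variables (R : realType) (A : cstarAlgType R).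
Implicit Types (a b c l x y z : A) (u v : nat -> A) (r t : R).
Local Notation cvg_to := (norm_cvg (@cnorm R A)).

Lemma ccvgP u l : cvg_to u l <-> forall e : R, 0 < e ->
  exists N : nat, forall n, (N <= n)%N -> cnorm (u n - l) < e.
Proof. exact/norm_cvgP/cnorm_ge0. Qed.

Lemma ccvg_lip (k : R) u v l m :
  (forall n, cnorm (v n - m) <= k * cnorm (u n - l)) -> cvg_to u l -> cvg_to v m.
Proof.
move=> le /ccvgP ul; apply/ccvgP => e e0.
(* The sign of [k] is arbitrary; [|k| + 1] is a positive divisor above it. *)
have k1 : 0 < `|k| + 1 by rewrite ltr_pwDr.
have [N hN] := ul _ (divr_gt0 e0 k1); exists N => n /hN.
rewrite ltr_pdivlMr // => h; apply: le_lt_trans (le n) _.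
apply: le_lt_trans h; rewrite mulrC ler_wpM2l ?cnorm_ge0 //.
by have := ler_norm k; lra.
Qed.

Lemma ccvgD u v l m : cvg_to u l -> cvg_to v m ->
  cvg_to (fun n => u n + v n) (l + m).
Proof.
move=> /ccvgP ul /ccvgP vm; apply/ccvgP => e e0.
have e2 : 0 < e / 2 by lra.
have [N hN] := ul _ e2; have [M hM] := vm _ e2.
exists (maxn N M) => n; rewrite geq_max => /andP[/hN h1 /hM h2].
rewrite opprD addrACA; have := cnormD_le (u n - l) (v n - m); lra.
Qed.

Lemma ccvg_mull c u l : cvg_to u l -> cvg_to (fun n => c * u n) (c * l).
Proof. by apply: (ccvg_lip (k := cnorm c)) => n; rewrite -mulrBr cnormM_le. Qed.

Lemma ccvg_mulr c u l : cvg_to u l -> cvg_to (fun n => u n * c) (l * c).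
Proof.
by apply: (ccvg_lip (k := cnorm c)) => n; rewrite -mulrBl mulrC cnormM_le.
Qed.

Lemma ccvgZ r u l : cvg_to u l -> cvg_to (fun n => r%:C *: u n) (r%:C *: l).
Proof. by apply: (ccvg_lip (k := `|r|)) => n; rewrite -scalerBr cnormZr. Qed.

Lemma ccvgN u l : cvg_to u l -> cvg_to (fun n => - u n) (- l).
Proof. by apply: (ccvg_lip (k := 1)) => n; rewrite -opprD cnormN mul1r. Qed.

Lemma ccvg_star u l : cvg_to u l -> cvg_to (fun n => star (u n)) (star l).
Proof. by apply: (ccvg_lip (k := 1)) => n; rewrite -starB cnorm_star mul1r. Qed.

Lemma ccvg_unique u l m : cvg_to u l -> cvg_to u m -> l = m.
Proof.
move=> /ccvgP ul /ccvgP um; apply/eqP; rewrite -subr_eq0; apply/eqP/cnorm0_eq0.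
apply/eqP/negPn/negP => n0.
have e2 : 0 < cnorm (l - m) / 2 by rewrite divr_gt0 // lt_def n0 cnorm_ge0.
have [N hN] := ul _ e2; have [M hM] := um _ e2.
have := hN _ (leq_maxl N M); have := hM _ (leq_maxr N M).
have := cnormB_le (u (maxn N M) - m) (u (maxn N M) - l).
by rewrite opprB addrC addrA subrK; lra.
Qed.

(** Picard iteration from 0, with [F] controlled only on the ball of radius [r]. It produces the
    inverse of 1 - y and, later, square roots. *)
Lemma contraction_fixpoint (F : A -> A) (r k : R) : 0 <= r -> 0 <= k < 1 ->
  (forall x, cnorm x <= r -> cnorm (F x) <= r) ->
  (forall x y, cnorm x <= r -> cnorm y <= r ->
     cnorm (F x - F y) <= k * cnorm (x - y)) ->
  exists2 y, cnorm y <= r & F y = y.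
Proof.
move=> r0 /andP[k0 k1] Fr Fk.
have iter_r n x : cnorm x <= r -> cnorm (iter n F x) <= r.
  by elim: n => //= n IH /IH; apply: Fr.
have iter_k n x y : cnorm x <= r -> cnorm y <= r ->
    cnorm (iter n F x - iter n F y) <= k ^+ n * cnorm (x - y).
  move=> xr yr; elim: n => [|n IH]; first by rewrite expr0 mul1r.
  rewrite !iterS exprS -mulrA (le_trans (Fk _ _ _ _)) ?iter_r //.
  by rewrite ler_wpM2l.
pose u n := iter n F 0.
have ur n : cnorm (u n) <= r by rewrite iter_r // cnorm0.
have dist n m : (n <= m)%N -> cnorm (u m - u n) <= k ^+ n * (2 * r).
  move=> /subnK <-; rewrite addnC /u iterD.
  apply: le_trans (iter_k _ _ _ _ _) _; rewrite ?iter_r ?cnorm0 //.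
  rewrite ler_wpM2l ?exprn_ge0 // subr0 (le_trans (ur (m - n)%N)) //; lra.
have knto e : 0 < e -> exists N, k ^+ N * (2 * r) < e.
  move=> e0; have r1 : 0 < 2 * r + 1 by lra.
  have : ((fun n => k ^+ n) @ \oo --> (0 : R))%classic.
    by apply: cvg_expr; rewrite ger0_norm.
  move/cvgrPdist_lt => /(_ _ (divr_gt0 e0 r1)) [N _ /(_ N (leqnn N))] /=.
  rewrite sub0r normrN ger0_norm ?exprn_ge0 // ltr_pdivlMr // => h.
  exists N; apply: le_lt_trans h; rewrite ler_wpM2l ?exprn_ge0 //; lra.
have [l /ccvgP ul] : exists l, cvg_to u l.
  apply: cnorm_complete => e e0.
  have [N hN] := knto _ (divr_gt0 e0 (ltr0Sn _ 1)).
  exists N => m n Nm Nn.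
  have := cnormB_le (u m - u N) (u n - u N); rewrite opprB addrA subrK.
  have := dist _ _ Nm; have := dist _ _ Nn; lra.
have lr : cnorm l <= r.
  apply/ler_addgt0Pr => e /ul [N /(_ _ (leqnn N))].
  have := cnorm_sub_le l (u N); rewrite cdistC; have := ur N; lra.
exists l => //; apply/eqP; rewrite -subr_eq0; apply/eqP/cnorm0_eq0/le_anti.
rewrite cnorm_ge0 andbT; apply/ler_addgt0Pr => e e0; rewrite add0r.
have [N hN] := ul _ (divr_gt0 e0 (ltr0Sn _ 1)).
have h1 := hN _ (leqnn N); have h2 := hN _ (leqnSn N).
have h3 : cnorm (F (u N) - F l) <= cnorm (u N - l).
  by apply: le_trans (Fk _ _ _ _) _ => //; rewrite ler_piMl ?cnorm_ge0 ?(ltW k1).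
have := cnormB_le (u N.+1 - l) (F (u N) - F l).
rewrite /u /= -/(u N) in h2 *; rewrite opprB addrC addrA subrK; lra.
Qed.

End CStarLimits.

(** * Invertible elements and the spectrum of self-adjoint elements *)

Section Invertibility.
Local Open Scope complex_scope.
Variables (R : realType) (A : cstarAlgType R).
Implicit Types (a b c g h x y z : A) (r t : R) (k : R[i]).

(** Phrased so that [spectrum a k] unfolds to [~ invertible (k%:A - a)]. *)
Definition invertible a : Prop := exists b, b * a = 1 /\ a * b = 1.

Lemma invertibleM a b : invertible a -> invertible b -> invertible (a * b).
Proof.
move=> [a' [a1 a2]] [b' [b1 b2]]; exists (b' * a'); split.
  by rewrite mulrA -(mulrA b') a1 mulr1.
by rewrite mulrA -(mulrA a) b2 mulr1.
Qed.

Lemma invertibleZ k a : k != 0 -> invertible a -> invertible (k *: a).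
Proof.
move=> k0 [b [b1 b2]]; exists (k^-1 *: b).
by rewrite -!scalerAl -!scalerAr b1 b2 !scalerA mulVf ?mulfV // scale1r.
Qed.

Lemma invertibleN a : invertible a -> invertible (- a).
Proof.
by rewrite -scaleN1r; apply: invertibleZ; rewrite oppr_eq0 oner_eq0.
Qed.

Lemma not_invertible0 : ~ invertible 0.
Proof. by move=> [b [/eqP]]; rewrite mulr0 eq_sym oner_eq0. Qed.

(** Fixed points of x -> 1 + yx and x -> 1 + xy are a right and a left inverse of 1 - y, and these
    coincide. *)
Lemma invertible_neumann y : cnorm y < 1 -> invertible (1 - y).
Proof.
move=> y1; have y0 := cnorm_ge0 y.
have p : 0 < 1 - cnorm y by lra.
(* This radius solves 1 + |y| r = r, so both maps preserve the ball. *)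
pose r := (1 - cnorm y)^-1.
have r0 : 0 <= r by rewrite invr_ge0 ltW.
have re : 1 + cnorm y * r = r.
  by apply: (mulfI (lt0r_neq0 p)); rewrite mulrDr mulrCA mulfV ?lt0r_neq0; lra.
have [||||z _ ez] := @contraction_fixpoint _ _ (fun x => 1 + y * x) r (cnorm y).
- by [].
- by rewrite y0.
- move=> x xr; apply: le_trans (cnormD_le _ _) _; rewrite cnorm1 -[leRHS]re.
  by rewrite lerD2l (le_trans (cnormM_le _ _)) // ler_wpM2l.
- by move=> x x' _ _; rewrite opprD addrACA subrr add0r -mulrBr cnormM_le.
have [||||z' _ ez'] := @contraction_fixpoint _ _ (fun x => 1 + x * y) r (cnorm y).
- by [].
- by rewrite y0.
- move=> x xr; apply: le_trans (cnormD_le _ _) _; rewrite cnorm1 -[leRHS]re.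
  by rewrite lerD2l mulrC (le_trans (cnormM_le _ _)) // ler_wpM2r.
- move=> x x' _ _; rewrite opprD addrACA subrr add0r -mulrBl mulrC.
  exact: cnormM_le.
have right : (1 - y) * z = 1 by rewrite mulrBl mul1r -{1}ez addrK.
have left : z' * (1 - y) = 1 by rewrite mulrBr mulr1 -{1}ez' addrK.
exists z; split=> //.
by rewrite -[z]mul1r -{1}left -(mulrA z') right mulr1.
Qed.

(** Write a = k (1 - k^-1 (k - a)), where k^-1 (k - a) has norm below 1. *)
Lemma invertible_near k a : cnorm (k%:A - a) < complex.Re `|k| -> invertible a.
Proof.
have [->|k0] := eqVneq k 0.
  rewrite normr0; have := cnorm_ge0 (0%:A - a).
  by move=> /le_lt_trans h /h; rewrite ltxx.
move=> h; have -> : a = k *: (1 - k^-1 *: (k%:A - a)).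
  by rewrite !scalerBr !scalerA mulfV // mul1r scale1r opprB addrC subrK.
apply: (invertibleZ k0); apply: invertible_neumann; rewrite cnormZ.
have kn : 0 < complex.Re `|k| by apply: le_lt_trans h; apply: cnorm_ge0.
have -> : complex.Re `|k^-1| = (complex.Re `|k|)^-1.
  by rewrite normfV normc_def -fmorphV.
by rewrite mulrC ltr_pdivrMr // mul1r.
Qed.

Lemma invertible_near_real t a : cnorm (t%:C%:A - a) < t -> invertible a.
Proof.
move=> h; apply: (@invertible_near t%:C); apply: lt_le_trans h _.
by rewrite normc_def /= expr0n /= addr0 sqrtr_sqr ler_norm.
Qed.

Lemma spectrum_bound a k : spectrum a k -> complex.Re `|k| <= cnorm a.
Proof.
move=> h; rewrite leNgt; apply/negP => lt; apply: h.
by apply: (@invertible_near k); rewrite opprB addrC subrK.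
Qed.

(* 'i - c is closer to (1 + t) 'i than 1 + t, as |c + t 'i|^2 <= t + t^2. *)
Lemma invertible_sa_i c : star c = c -> invertible ('i%:A - c).
Proof.
move=> sc; pose t := cnorm c ^+ 2; have t0 : 0 <= t by rewrite exprn_ge0 ?cnorm_ge0.
apply: (@invertible_near ((1 + t)%:C * 'i)).
have -> : complex.Re `|(1 + t)%:C * 'i| = 1 + t.
  rewrite normrM !normc_def /=.
  rewrite !(expr0n, expr1n, mul0r, mulr0, add0r, addr0, subr0) /=.
  by rewrite sqrtr_sqr sqrtr1 mulr1 ger0_norm ?addr_ge0.
have -> : ((1 + t)%:C * 'i)%:A - ('i%:A - c) = t%:C *: 'i%:A + c.
  rewrite opprB addrA addrAC rmorphD rmorph1 mulrDl mul1r scalerDl -scalerA.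
  by rewrite [X in X - _]addrC addrK.
rewrite -ltr_sqr ?nnegrE ?cnorm_ge0 ?addr_ge0 //.
rewrite -cnorm_star_mul starD sc starZr stari star1.
have -> : (t%:C *: - ('i *: 1) + c) * (t%:C *: ('i *: 1) + c) =
    (t ^+ 2)%:C *: 1 + c * c.
  rewrite scalerN !scalerA; set w := (t%:C * 'i)%:A.
  have wc : w * c = c * w by rewrite mulr_algl mulr_algr.
  have ww : w * w = - ((t ^+ 2)%:C)%:A.
    rewrite mulr_algl scalerA -scaleNr; congr (_ *: _).
    by rewrite mulrACA -rmorphM -[X in _ * X]expr2 sqr_i mulrN1 -expr2.
  by rewrite mulrDl !mulrDr mulNr ww opprK mulNr wc addrA subrK.
apply: le_lt_trans (cnormD_le _ _) _; rewrite cnorm_alg cnorm_sqr_sa // -/t.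
by rewrite ger0_norm ?exprn_ge0 ?cnorm_ge0 //; nra.
Qed.

(** Since r + ti - a = t (i - t^-1 (a - r)), the case of the scalar i suffices. *)
Lemma invertible_sa_nonreal a r t : star a = a -> t != 0 -> 
  invertible ((r%:C + t%:C * 'i)%:A - a).
Proof.
move=> sa t0; have tc : t%:C != 0 by rewrite eq_complex /= negb_and t0.
have -> : (r%:C + t%:C * 'i)%:A - a = t%:C *: ('i%:A - t^-1%:C *: (a - r%:C%:A)).
  rewrite scalerBr !scalerA -rmorphM mulfV // scale1r opprB addrA scalerDl.
  by rewrite [X in X - _]addrC.
apply: (invertibleZ tc); apply: invertible_sa_i.
by rewrite starZr starB star_alg sa.
Qed.

Lemma sa_spectrum_real a k : star a = a -> spectrum a k -> k = (complex.Re k)%:C.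
Proof.
move=> sa h; case: k h => x y h; have [->|y0] := eqVneq y 0; first by [].
case: h; have := @invertible_sa_nonreal a x y sa y0.
rewrite (_ : x%:C + y%:C * 'i = x +i* y) //; apply/eqP.
by rewrite eq_complex /= !(mul0r, mulr0, mulr1, subr0, addr0, add0r) !eqxx.
Qed.

End Invertibility.

(** * The norm in the spectrum, and the norm criterion for positivity *)

Section Positivity.
Local Open Scope complex_scope.
Variables (R : realType) (A : cstarAlgType R).
Implicit Types (a b c g h p q w x y z : A) (r t : R) (k : R[i]).

(** By the C*-identity, both squared norms are the norm of [star x] ([star z] z) x. *)
Lemma cnorm_normal z x : star z * z = z * star z ->
  cnorm (star z * x) = cnorm (z * x).
Proof.
move=> nz; apply/eqP.
rewrite -(@eqrXn2 _ 2) ?cnorm_ge0 //; apply/eqP.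
rewrite -!cnorm_star_mul !starM starK.
by rewrite !mulrA -[in RHS](mulrA _ (star z) z) -[in LHS](mulrA _ z (star z)) nz.
Qed.

(* With z = 1 + ib one has 1 + b^2 = z^* z and z^2 - (z^* )^2 = 4ib. *)
Lemma cnorm_1Dsqr_mul b w : star b = b ->
  2 * cnorm (b * w) <= cnorm ((1 + b ^+ 2) * w).
Proof.
move=> sb; pose z : A := 1 + 'i *: b; pose z' : A := 1 - 'i *: b.
have sz : star z = z' by rewrite starD star1 stari sb.
have ii : ('i *: b) * ('i *: b) = - b ^+ 2.
  rewrite -scalerAl -scalerAr scalerA -expr2 sqr_i scaleN1r //.
have zz' : z * z' = 1 + b ^+ 2.
  by rewrite mulrBr mulr1 mulrDl mul1r ii opprD opprK addrA addrK.
have z'z : z' * z = 1 + b ^+ 2.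
  by rewrite mulrDr mulr1 mulrBl mul1r ii opprK addrA subrK.
have nz : star z * z = z * star z by rewrite sz z'z zz'.
have n1 : cnorm (z * (z * w)) = cnorm ((1 + b ^+ 2) * w).
  by rewrite -cnorm_normal // sz mulrA z'z.
have n2 : cnorm (z' * (z' * w)) = cnorm ((1 + b ^+ 2) * w).
  by rewrite -sz cnorm_normal // sz mulrA zz'.
have e : z * (z * w) - z' * (z' * w) = 'i *: (4%:R%:C *: (b * w)).
  rewrite !mulrA -mulrBl -!expr2 /z /z' -[X in _ - X]sqrrN opprB [1 + _]addrC.
  rewrite sqrrD1 sqrrB1 opprD addrACA subrr addr0 opprB addrC addrA subrK -mulrnDr.
  by rewrite rmorph_nat scaler_nat scalerMnr -scalerAl mulrnAl.
have := cnormB_le (z * (z * w)) (z' * (z' * w)); rewrite e cnormi cnormZr n1 n2.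
by rewrite ger0_norm //; lra.
Qed.

(* 1 - b^(2^(k+1)) is 1 - b^2 times factors 1 + b^(2^j), 1 <= j <= k, each of
   which cnorm_1Dsqr_mul trades for 2 b^(2^(j-1)). *)
Lemma cnorm_telescope (k : nat) b w : star b = b ->
  2 ^+ k * cnorm (b ^+ (2 ^ k).-1 * ((1 - b ^+ 2) * w)) <=
  cnorm ((1 - b ^+ (2 ^ k.+1)) * w).
Proof.
elim: k b w => [|k IH] b w sb; first by rewrite !expr0 !mul1r.
have := IH (b ^+ 2) w (star_exp _ sb); rewrite -!exprM -!expnS.
apply: le_trans; rewrite exprSr -mulrA ler_wpM2l ?exprn_ge0 //.
(* The induction hypothesis at b^2 produces b^m; the missing factor b up to 2^(k+1) - 1 = m + 1
   comes from [cnorm_1Dsqr_mul]. *)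
set m := (2 * (2 ^ k).-1)%N.
have -> : (2 ^ k.+1).-1 = m.+1.
  rewrite /m expnS; have := expn_gt0 2 k.
  by case: (2 ^ k)%N => // n _; rewrite mulnS.
have -> : b ^+ m * ((1 - b ^+ (2 * 2)) * w) =
    (1 + b ^+ 2) * (b ^+ m * ((1 - b ^+ 2) * w)).
  have -> : 1 - b ^+ (2 * 2) = (1 + b ^+ 2) * (1 - b ^+ 2).
    by rewrite mulrBr mulr1 mulrDl mul1r -exprD opprD addrA addrK.
  rewrite !mulrA; congr (_ * _ * _).
  by rewrite mulrDr mulr1 mulrDl mul1r -!exprD addnC.
by apply: le_trans (cnorm_1Dsqr_mul _ sb); rewrite exprS !mulrA.
Qed.

Lemma not_invertible_1Bsqr b : star b = b -> cnorm b = 1 ->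
  ~ invertible (1 - b ^+ 2).
Proof.
move=> sb nb [w [_ ew]].
(* Chosen so that 2^n > n > 2 |w|. *)
pose n := (Num.Def.truncn (2 * cnorm w)).+1.
have := cnorm_telescope n w sb; rewrite ew mulr1.
(* The exponent 2^n - 1 need not be a power of 2; one more factor b, of norm 1, makes it one. *)
have le1 : 1 <= cnorm (b ^+ (2 ^ n).-1).
  have e : cnorm (b ^+ (2 ^ n)) = 1 by rewrite cnorm_exp2n // nb expr1n.
  have := cnormM_le b (b ^+ (2 ^ n).-1).
  by rewrite -exprS prednK ?expn_gt0 // e nb mul1r.
have le2 : cnorm ((1 - b ^+ (2 ^ n.+1)) * w) <= 2 * cnorm w.
  apply: le_trans (cnormM_le _ _) _; rewrite ler_wpM2r ?cnorm_ge0 //.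
  apply: le_trans (cnormB_le _ _) _.
  by rewrite cnorm1 cnorm_exp2n // nb expr1n.
have lt : 2 * cnorm w < 2 ^+ n.
  apply: lt_trans (truncnS_gt _) _.
  by rewrite -natrX ltr_nat ltn_expl.
move=> h; have := le_trans h le2.
have := ler_wpM2l (exprn_ge0 n (ler0n R 2)) le1; lra.
Qed.

(** Put r = |a| and b = a / r. If r - a and -r - a were both invertible, so would be 1 - b^2 = r^-1
    (r - a) r^-1 (r + a), although |b| = 1. *)
Lemma cnorm_in_spectrum a : star a = a ->
  spectrum a (cnorm a)%:C \/ spectrum a (- cnorm a)%:C.
Proof.
move=> sa; have [a0|n0] := eqVneq (cnorm a) 0.
  left; rewrite (cnorm0_eq0 _ a0) cnorm0 /spectrum /= scale0r subr0.
  exact: not_invertible0.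
set r := cnorm a in n0 *.
have r0 : r%:C != 0 by rewrite eq_complex /= negb_and n0.
apply: contrapT => /not_orP[n1 n2].
have i1 : invertible (r%:C%:A - a) by apply: contrapT.
have i2 : invertible ((- r)%:C%:A - a) by apply: contrapT.
pose b := r^-1%:C *: a.
apply: (@not_invertible_1Bsqr b).
- by rewrite starZr sa.
- by rewrite cnormZr ger0_norm ?invr_ge0 ?cnorm_ge0 // mulVf.
have -> : 1 - b ^+ 2 =
    (r%:C^-1 *: (r%:C%:A - a)) * (r%:C^-1 *: (- ((- r)%:C%:A - a))).
  rewrite opprB rmorphN scaleNr opprK !scalerBr !scalerDr !scalerA mulVf // scale1r.
  rewrite /b fmorphV mulrDr mulr1 mulrBl mul1r expr2.
  by rewrite [RHS]addrC addrA subrK.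
by apply: invertibleM; apply: invertibleZ; rewrite ?invr_eq0 //; apply: invertibleN.
Qed.

Lemma spectrumB r a k : spectrum (r%:C%:A - a) k -> spectrum a (r%:C - k).
Proof.
move=> h i; apply: h; have := invertibleN i; rewrite scalerBl.
by rewrite !opprB addrCA.
Qed.

(** If a is positive, one of t - |t - a| and t + |t - a| is in its spectrum: the first is then
    nonnegative, the second at most |a| <= t. Conversely, k in the spectrum of a gives |t - k| <= |t
    - a| <= t, so k >= 0. *)
Lemma cposP t a : star a = a -> cnorm a <= t ->
  (cpos a <-> cnorm (t%:C%:A - a) <= t).
Proof.
move=> sa at_; have sb : star (t%:C%:A - a) = t%:C%:A - a.
  by rewrite starB star_alg sa.
split=> [[_ pa]|le].
  have [/spectrumB|/spectrumB] := cnorm_in_spectrum sb.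
    by move/pa; rewrite -rmorphB ler0c subr_ge0.
  move=> h; have := spectrum_bound h.
  rewrite -rmorphB normc_def /= expr0n /= addr0 sqrtr_sqr.
  by have := ler_norm (t - - cnorm (t%:C%:A - a)); have := cnorm_ge0 a; lra.
split=> // k sk; have kr := sa_spectrum_real sa sk; rewrite kr ler0c.
have sk' : spectrum (t%:C%:A - a) (t%:C - k).
  by apply: spectrumB; rewrite opprB addrC subrK.
have := spectrum_bound sk'.
rewrite kr -rmorphB normc_def /= expr0n /= addr0 sqrtr_sqr.
by have := ler_norm (t - complex.Re k); lra.
Qed.

End Positivity.

(** * The positive cone, square roots, and order from norm inequalities *)

Section PositiveElements.
Local Open Scope complex_scope.
Variables (R : realType) (A : cstarAlgType R).
Implicit Types (a b c g h p q w x y z : A) (r t e : R) (k : R[i]).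

Lemma sa_alg_sub_pos a t : star a = a -> cnorm a <= t -> cpos (t%:C%:A - a).
Proof.
move=> sa le; have t0 := le_trans (cnorm_ge0 a) le.
have n1 : cnorm (t%:C%:A : A) = t by rewrite cnorm_alg ger0_norm.
(* At 2t the criterion reads |t + a| <= 2t. *)
apply/(@cposP _ _ (t + t)).
- by rewrite starB star_alg sa.
- by have := cnormB_le t%:C%:A a; rewrite n1; lra.
rewrite rmorphD scalerDl opprB addrC addrA subrK addrC.
by have := cnormD_le t%:C%:A a; rewrite n1; lra.
Qed.

(** For positive a the spectrum contains |a| itself, so t - |a| is in the spectrum of t - a. *)
Lemma cpos_cnorm_le a t : cpos a -> cpos (t%:C%:A - a) -> cnorm a <= t.
Proof.
move=> [sa pa] [_ pta].
have h : spectrum a (cnorm a)%:C.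
  case: (cnorm_in_spectrum sa) => // h.
  suff a0 : cnorm a = 0 by rewrite a0 in h *; rewrite oppr0 in h.
  by have := pa _ h; rewrite ler0c; have := cnorm_ge0 a; lra.
have /pta : spectrum (t%:C%:A - a) (t%:C - (cnorm a)%:C).
  by apply: spectrumB; rewrite opprB addrC subrK.
by rewrite -rmorphB ler0c subr_ge0.
Qed.

(** The criterion at |a| + |b| splits by the triangle inequality. *)
Lemma cposD a b : cpos a -> cpos b -> cpos (a + b).
Proof.
move=> pa pb; have [sa _] := pa; have [sb _] := pb.
apply/(@cposP _ _ (cnorm a + cnorm b)).
- by rewrite starD sa sb.
- exact: cnormD_le.
rewrite rmorphD scalerDl opprD addrACA; apply: le_trans (cnormD_le _ _) _.
by apply: lerD; apply/cposP.
Qed.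

Lemma cpos_sum I (s : seq I) (P : pred I) (F : I -> A) :
  (forall i, cpos (F i)) -> cpos (\sum_(i <- s | P i) F i).
Proof.
move=> pF; apply: (big_ind (@cpos R A)) => //; last exact: cposD.
have := @sa_alg_sub_pos 0 0 (star0 A); rewrite cnorm0 scale0r subr0; exact.
Qed.

Lemma cposZ r a : 0 <= r -> cpos a -> cpos (r%:C *: a).
Proof.
move=> r0 pa; have [sa _] := pa; apply/(@cposP _ _ (r * cnorm a)).
- by rewrite starZr sa.
- by rewrite cnormZr ger0_norm.
rewrite rmorphM -scalerA -scalerBr cnormZr ger0_norm // ler_wpM2l //.
exact/cposP.
Qed.

Lemma cpos_limit (u : nat -> A) l :
  (forall n, cpos (u n)) -> norm_cvg (@cnorm R A) u l -> cpos l.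
Proof.
move=> pu ul; have sl : star l = l.
  apply: ccvg_unique (ul); have := ccvg_star ul; congr (norm_cvg _ _ _).
  by apply: funext => n; case: (pu n).
apply/(@cposP _ _ (cnorm l)) => //; apply/ler_addgt0Pr => e e0.
have /ccvgP ul' := ul.
have [N /(_ N (leqnn N)) h] := ul' _ (divr_gt0 e0 (ltr0Sn _ 3)).
have [sN _] := pu N.
have h1 : cnorm ((cnorm (u N))%:C%:A - u N) <= cnorm (u N) by apply/cposP.
have h2 := cnorm_sub_le (u N) l.
(* This [t] dominates |u N|, so the criterion applies to [u N]; passing to [l] costs 3 |u N - l| in
   all, whence e / 4 above. *)
pose t := cnorm l + cnorm (u N - l).
have h3 : cnorm (t%:C%:A - u N) <= t by apply/cposP; rewrite // /t; lra.
have -> : (cnorm l)%:C%:A - l =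
    (t%:C%:A - u N) + ((u N - l) - (cnorm (u N - l))%:C%:A).
  by rewrite /t rmorphD scalerDl !addrA subrK addrAC addrK.
have := cnormD_le (t%:C%:A - u N) ((u N - l) - (cnorm (u N - l))%:C%:A).
have := cnormB_le (u N - l) (cnorm (u N - l))%:C%:A.
by rewrite cnorm_alg (ger0_norm (cnorm_ge0 _)) /t in h3 *; lra.
Qed.

Lemma cle_cnorm a b : cpos a -> cle a b -> cnorm a <= cnorm b.
Proof.
move=> pa lab; apply: cpos_cnorm_le => //.
have -> : (cnorm b)%:C%:A - a = ((cnorm b)%:C%:A - b) + (b - a).
  by rewrite addrA subrK.
apply: cposD => //; apply: sa_alg_sub_pos => //.
(* Self-adjointness of b comes from that of a and b - a. *)
have [sa _] := pa; have [] := lab; rewrite starB sa => + _.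
by move/(congr1 (+%R^~ a)); rewrite !subrK.
Qed.

(** A real r < 0 is the square of some k' = im with m nonzero, and r - h^2 = (k' - h)(k' + h) has
    invertible factors, as self-adjoint elements have real spectrum. *)
Lemma cpos_sqr h : star h = h -> cpos (h * h).
Proof.
move=> sh; have shh : star (h * h) = h * h by rewrite starM sh.
split=> // k sk; have kr := sa_spectrum_real shh sk.
rewrite kr ler0c leNgt; apply/negP => k0; apply: sk; rewrite kr.
set r := complex.Re k in k0 *; pose m := Num.sqrt (- r).
have m0 : m != 0 by rewrite sqrtr_eq0 -ltNge; lra.
have rE : r = - (m * m) by rewrite -expr2 sqr_sqrtr; lra.
pose k' := m%:C * 'i; have kk : r%:C = k' * k'.
  by rewrite mulrACA -rmorphM -[X in _ * X]expr2 sqr_i mulrN1 -rmorphN -rE.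
have ik x : star x = x -> invertible (k'%:A - x).
  by move=> sx; have := invertible_sa_nonreal 0 sx m0; rewrite rmorph0 add0r.
have i1 := ik _ sh.
have i2 : invertible (k'%:A - - h) by apply: ik; rewrite starN sh.
have := invertibleM i1 i2; congr invertible; rewrite kk.
by rewrite opprK mulrBl !mulrDr !mulr_algl mulr_algr scalerA opprD addrA addrK.
Qed.

Lemma star_inverse g h : star g = g -> h * g = 1 -> g * h = 1 -> star h = h.
Proof.
move=> sg hg gh; rewrite -[LHS]mulr1 -gh mulrA -{1}sg -starM gh star1 mul1r //.
Qed.

(** Equality would put t or -t in the spectrum of t - a, hence 0 or 2t in that of a: invertibility
    excludes 0, and |a| <= t excludes 2t. *)
Lemma cpos_invertible_lt a t : cpos a -> invertible a -> cnorm a <= t -> 0 < t ->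
  cnorm (t%:C%:A - a) < t.
Proof.
move=> pa ia le t0; have [sa pa'] := pa.
have := (cposP sa le).1 pa; rewrite le_eqVlt => /orP[/eqP e|//].
have sb : star (t%:C%:A - a) = t%:C%:A - a by rewrite starB star_alg sa.
have [/spectrumB|/spectrumB] := cnorm_in_spectrum sb; rewrite e.
  by rewrite subrr => h; case: h; rewrite scale0r sub0r; apply: invertibleN.
move=> h; have := spectrum_bound h.
rewrite -rmorphB normc_def /= expr0n /= addr0 sqrtr_sqr.
by have := ler_norm (t - - t); lra.
Qed.

Lemma cpos_invertibleD a b : cpos a -> cpos b -> invertible b -> invertible (a + b).
Proof.
move=> pa pb ib; have [sa _] := pa; pose t := cnorm b + 1.
have t0 : 0 < t by rewrite /t; have := cnorm_ge0 b; lra.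
apply: (@invertible_near_real _ _ (cnorm a + t)).
rewrite rmorphD scalerDl opprD addrACA; apply: le_lt_trans (cnormD_le _ _) _.
apply: ler_ltD; first exact/cposP.
by apply: cpos_invertible_lt => //; rewrite /t; lra.
Qed.

(** With h = g^-1 and r < 0, r - gpg = -g (p + (-r) h^2) g, where the middle factor is a positive
    element plus a positive invertible one. *)
Lemma cpos_conj p g : cpos p -> star g = g -> invertible g -> cpos (g * p * g).
Proof.
move=> pp sg [h [hg gh]]; have [sp _] := pp.
have sh := star_inverse sg hg gh.
have ig : invertible g by exists h.
have ih : invertible h by exists g.
have sgpg : star (g * p * g) = g * p * g by rewrite !starM sg sp mulrA.
split=> // k sk; have kr := sa_spectrum_real sgpg sk.
rewrite kr ler0c leNgt; apply/negP => k0; apply: sk; rewrite kr.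
set r := complex.Re k in k0 *.
have nr0 : (- r)%:C != 0 by rewrite eq_complex /= negb_and oppr_eq0 lt_eqF.
have -> : r%:C%:A - g * p * g = - (g * (p + (- r)%:C *: (h * h)) * g).
  rewrite mulrDr mulrDl opprD addrC -scalerAr -scalerAl mulrA gh mul1r hg.
  by rewrite rmorphN scaleNr opprK.
apply: invertibleN; apply: invertibleM => //; apply: invertibleM => //.
apply: cpos_invertibleD => //; first by apply: cposZ; [lra | apply: cpos_sqr].
by apply: invertibleZ => //; apply: invertibleM.
Qed.

(** Rescaling q + e to 1 - p with |p| < 1 reduces the root to a fixed point problem; e > 0 makes the
    contraction strict and the root invertible. *)
Lemma cpos_sqrt q e : cpos q -> 0 < e ->
  exists g, [/\ star g = g, invertible g & g * g = q + e%:C%:A].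
Proof.
move=> pq e0; have [sq _] := pq; have nq := cnorm_ge0 q.
pose N := cnorm q + e; have N0 : 0 < N by rewrite /N; lra.
have Nc : N%:C != 0 by rewrite eq_complex /= negb_and lt0r_neq0.
pose p := N^-1%:C *: ((cnorm q)%:C%:A - q); pose r := cnorm q / N.
have r0 : 0 <= r by rewrite divr_ge0 // ltW.
have r1 : r < 1 by rewrite ltr_pdivrMr // /N; lra.
have np : cnorm p <= r.
  have N1 : 0 <= N^-1 by rewrite invr_ge0 ltW.
  rewrite cnormZr ger0_norm // mulrC ler_wpM2r //.
  exact/cposP.
have sp : star p = p by rewrite starZr starB star_alg sq.
(* A fixed point y of F satisfies (1 - y)^2 = 1 - p, and N (1 - p) = q + e. *)
pose F y := 2^-1%:C *: (p + y * y).
have Fk x y : cnorm x <= r -> cnorm y <= r ->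
    cnorm (F x - F y) <= r * cnorm (x - y).
  move=> xr yr; rewrite /F -scalerBr cnormZr ger0_norm ?invr_ge0 //.
  rewrite opprD addrACA subrr add0r.
  have -> : x * x - y * y = x * (x - y) + (x - y) * y.
    by rewrite mulrBr mulrBl addrA subrK.
  have h1 := le_trans (cnormM_le x (x - y)) (ler_wpM2r (cnorm_ge0 (x - y)) xr).
  have h2 := le_trans (cnormM_le (x - y) y) (ler_wpM2l (cnorm_ge0 (x - y)) yr).
  have := cnormD_le (x * (x - y)) ((x - y) * y); rewrite mulrC in h2.
  lra.
have [||||y yr Fy] := @contraction_fixpoint _ _ F r r.
- by [].
- by rewrite r0.
- move=> x xr; rewrite /F cnormZr ger0_norm ?invr_ge0 //.
  have h1 := le_trans (cnormM_le x x) (ler_pM (cnorm_ge0 x) (cnorm_ge0 x) xr xr).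
  have := cnormD_le p (x * x); nra.
- exact: Fk.
(* [star y] is also fixed by [F], and a contraction has at most one fixed point in the ball. *)
have sy : star y = y.
  have yr' : cnorm (star y) <= r by rewrite cnorm_star.
  have := Fk _ _ yr' yr; rewrite Fy.
  have -> : F (star y) = star y.
    by have := congr1 star Fy; rewrite /F starZr starD sp starM.
  move=> h; apply/eqP; rewrite -subr_eq0; apply/eqP/cnorm0_eq0/le_anti.
  by rewrite cnorm_ge0 andbT; have := cnorm_ge0 (star y - y); nra.
pose s := Num.sqrt N; have s0 : s != 0 by rewrite sqrtr_eq0 -ltNge.
exists (s%:C *: (1 - y)); split.
- by rewrite starZr starB star1 sy.
- apply: invertibleZ; first by rewrite eq_complex /= negb_and s0.
  by apply: invertible_neumann; lra.
rewrite -scalerAl -scalerAr scalerA -rmorphM -expr2 sqr_sqrtr ?(ltW N0) //.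
have -> : (1 - y) * (1 - y) = 1 - p.
  have : 2%:R%:C *: F y = p + y * y.
    by rewrite /F scalerA -rmorphM mulfV ?scale1r ?pnatr_eq0.
  rewrite Fy rmorph_nat scaler_nat mulr2n => h.
  rewrite mulrBr mulr1 mulrBl mul1r opprB.
  have -> : p = y + y - y * y by rewrite h addrK.
  by rewrite -addrA [- y + _]addrCA opprB opprD.
rewrite scalerBr /p scalerA -rmorphM mulfV ?lt0r_neq0 // scale1r opprB.
by rewrite /N rmorphD scalerDl addrC addrA subrK.
Qed.

(* For q + e = g^2 and h = g^-1, the hypothesis on h gives h p h <= C, and
   multiplying by g on both sides gives p <= C (q + e). *)
Lemma cle_of_conj_cnorm p q (C : R) : star p = p -> cpos q -> 0 <= C ->
  (forall h, star h = h -> cnorm (h * p * h) <= C * cnorm (h * q * h)) ->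
  cle p (C%:C *: q).
Proof.
move=> sp pq C0 hpq.
have le e : 0 < e -> cpos (C%:C *: (q + e%:C%:A) - p).
  move=> e0; have [g [sg ig gg]] := cpos_sqrt pq e0.
  have [h [hg gh]] := ig; have sh := star_inverse sg hg gh.
  have hgg : h * (g * g) * h = 1 by rewrite mulrA hg mul1r gh.
  (* Because 1 = h (q + e) h, the difference 1 - hqh is e h^2, which is positive. *)
  have nq : cnorm (h * q * h) <= 1.
    apply: cpos_cnorm_le; first by apply: cpos_conj => //; exists g.
    rewrite scale1r -hgg gg mulrDr mulrDl addrAC subrr add0r mulr_algr -scalerAl.
    by apply: cposZ; [exact: ltW | apply: cpos_sqr].
  have np : cnorm (h * p * h) <= C.
    by apply: le_trans (hpq _ sh) _; rewrite ler_piMr.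
  have shph : star (h * p * h) = h * p * h by rewrite !starM sh sp mulrA.
  have := cpos_conj (sa_alg_sub_pos shph np) sg ig.
  rewrite mulrBr mulrBl mulr_algr -scalerAl gg !mulrA gh mul1r -mulrA hg mulr1.
  exact.
apply: (@cpos_limit (fun n => C%:C *: (q + (n.+1%:R^-1)%:C%:A) - p)).
  by move=> n; apply: le; rewrite invr_gt0.
apply/ccvgP => e e0.
pose N := Num.Def.truncn (C / e); exists N => n Nn.
rewrite opprB addrA subrK -scalerBr addrAC subrr add0r cnormZr cnorm_alg.
rewrite !ger0_norm ?invr_ge0 //.
rewrite ltr_pdivrMr // mulrC -ltr_pdivrMr //.
by apply: lt_le_trans (truncnS_gt _) _; rewrite ler_nat.
Qed.

End PositiveElements.

(** * Inner products and adjointable maps *)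

Section HilbertModules.
Local Open Scope complex_scope.
Variables (R : realType) (A : cstarAlgType R) (H : hilbertModType A).
Implicit Types (x y z : H) (c h : A) (T S K : adjointable H).

Lemma dotDr x y z : dot x (y + z) = dot x y + dot x z.
Proof. by rewrite dot_star dotDl starD -!dot_star. Qed.

Lemma dotZr c x y : dot x (c *: y) = dot x y * star c.
Proof. by rewrite dot_star dotZl starM -dot_star. Qed.

Lemma dotNl x y : dot (- x) y = - dot x y.
Proof. by rewrite -scaleN1r dotZl mulN1r. Qed.

Lemma dotNr x y : dot x (- y) = - dot x y.
Proof. by rewrite dot_star dotNl starN -dot_star. Qed.

(** Nondegeneracy, by testing against x - y; it yields the [A]-homogeneity of adjointable maps and
    their adjoints. *)
Lemma dot_injl x y : (forall z, dot x z = dot y z) -> x = y.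
Proof.
move=> e; apply/eqP; rewrite -subr_eq0; apply/eqP/dot_eq0.
by rewrite dotDl dotNl e subrr.
Qed.

Lemma adjointableZ T c x : T (c *: x) = c *: T x.
Proof. by apply: dot_injl => z; rewrite adjP !dotZl adjP. Qed.

Lemma adjZ T c x : adj T (c *: x) = c *: adj T x.
Proof.
apply: dot_injl => z; rewrite dot_star [RHS]dot_star; congr star.
by rewrite -adjP !dotZr adjP.
Qed.

Lemma dotZZ c x : dot (c *: x) (c *: x) = c * dot x x * star c.
Proof. by rewrite dotZl dotZr mulrA. Qed.

(** By the parallelogram law, the gap is [dot (x + y) (x + y)]. *)
Lemma dot_sub_le x y :
  cle (dot (x - y) (x - y)) (2%:R%:C *: (dot x x + dot y y)).
Proof.
rewrite /cle (_ : _ - _ = dot (x + y) (x + y)); first exact: dot_ge0.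
apply/eqP; rewrite subr_eq; apply/eqP.
rewrite !dotDl !dotDr !dotNl !dotNr opprK rmorph_nat scaler_nat mulr2n.
rewrite [RHS]addrACA [X in _ = X + _]addrACA [X in _ = _ + X]addrACA.
by rewrite !subrr addr0 add0r addrACA.
Qed.

Lemma hnorm_sqr x : hnorm x ^+ 2 = cnorm (dot x x).
Proof. by rewrite sqr_sqrtr // cnorm_ge0. Qed.

End HilbertModules.

(** * Sums over families of operators, and frame bounds through norms *)

Section FrameSums.
Local Open Scope complex_scope.
Variables (R : realType) (A : cstarAlgType R) (H : hilbertModType A).
Variable J : set nat.
Implicit Types (x : H) (d s t : A) (f g : nat -> H -> H).
Implicit Types (T S K : adjointable H).

Lemma frame_sumZ f c x s : (forall i, f i (c *: x) = c *: f i x) ->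
  frame_sum J f x s -> frame_sum J f (c *: x) (c * s * star c).
Proof.
move=> fZ fs; have := ccvg_mulr (star c) (ccvg_mull c fs).
congr (norm_cvg _ _ _); apply: funext => n.
rewrite mulr_sumr mulr_suml; apply: eq_bigr => i _.
by rewrite fZ dotZZ.
Qed.

Lemma frame_sum_pos f x s : frame_sum J f x s -> cpos s.
Proof. by apply: cpos_limit => n; apply: cpos_sum => i; apply: dot_ge0. Qed.

Lemma partial_sum_sub_le f g x (m n : nat) :
  cle (\sum_(m <= i < n | i \in J) dot (f i x - g i x) (f i x - g i x))
      (2%:R%:C *: (\sum_(m <= i < n | i \in J) dot (f i x) (f i x) +
                   \sum_(m <= i < n | i \in J) dot (g i x) (g i x))).
Proof.
rewrite -big_split /= scaler_sumr /cle -sumrB.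
by apply: cpos_sum => i; apply: dot_sub_le.
Qed.

(** The parallelogram inequality passes from partial sums to limits, as the cone is closed, and the
    norm is monotone on the cone. *)
Lemma cnorm_frame_sum_sub f g x d s t :
  frame_sum J f x s -> frame_sum J g x t ->
  frame_sum J (fun i y => f i y - g i y) x d ->
  cnorm d <= 2 * (cnorm s + cnorm t).
Proof.
move=> fs gt hd.
have le : cle d (2%:R%:C *: (s + t)).
  apply: cpos_limit (ccvgD (ccvgZ 2 (ccvgD fs gt)) (ccvgN hd)) => n.
  exact: partial_sum_sub_le.
apply: le_trans (cle_cnorm (frame_sum_pos hd) le) _.
by rewrite cnormZr ger0_norm // ler_wpM2l // cnormD_le.
Qed.

Lemma frame_sum_sub_exists f g x s t :
  frame_sum J f x s -> frame_sum J g x t ->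
  exists d, frame_sum J (fun i y => f i y - g i y) x d.
Proof.
move=> /ccvgP fs /ccvgP gt; apply: cnorm_complete => e e0.
(* Partial sums within e / 8 of their limits have blocks below e / 4, and 2 (e / 4 + e / 4) = e. *)
have e8 : 0 < e / 8%:R by rewrite divr_gt0.
have [N hN] := fs _ e8; have [M hM] := gt _ e8.
pose P i : bool := i \in J.
have tail (u : nat -> A) l N' m n : (forall k, (N' <= k)%N ->
    cnorm (\sum_(0 <= i < k | P i) u i - l) < e / 8%:R) ->
    (N' <= m)%N -> (m <= n)%N -> cnorm (\sum_(m <= i < n | P i) u i) < e / 4%:R.
  move=> hu Nm mn; have h1 := hu _ Nm; have h2 := hu _ (leq_trans Nm mn).
  have := cnormB_le (\sum_(0 <= i < n | P i) u i - l)
    (\sum_(0 <= i < m | P i) u i - l).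
  have -> : \sum_(m <= i < n | P i) u i =
      \sum_(0 <= i < n | P i) u i - \sum_(0 <= i < m | P i) u i.
    by rewrite (big_cat_nat (leq0n m) mn) /= [X in _ = X - _]addrC addrK.
  rewrite opprB addrA subrK; lra.
have main m n : (maxn N M <= m)%N -> (m <= n)%N ->
    cnorm (\sum_(m <= i < n | P i) dot (f i x - g i x) (f i x - g i x)) < e.
  rewrite geq_max => /andP[Nm Mm] mn.
  have pos : cpos (\sum_(m <= i < n | P i) dot (f i x - g i x) (f i x - g i x)).
    by apply: cpos_sum => i; apply: dot_ge0.
  apply: le_lt_trans (cle_cnorm pos (partial_sum_sub_le f g x m n)) _.
  rewrite cnormZr ger0_norm //.
  have h1 := tail _ _ _ _ _ hN Nm mn; have h2 := tail _ _ _ _ _ hM Mm mn.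
  have := cnormD_le (\sum_(m <= i < n | P i) dot (f i x) (f i x))
     (\sum_(m <= i < n | P i) dot (g i x) (g i x)); lra.
exists (maxn N M) => m n hm hn.
wlog mn : m n hm hn / (m <= n)%N => [wl|].
  by case/orP: (leq_total m n) => [|nm]; [exact: wl | rewrite cdistC; exact: wl].
rewrite cdistC (big_cat_nat (leq0n m) mn) /= [X in X - _]addrC addrK.
exact: main.
Qed.

(** At [h *: x] with h self-adjoint, the norm hypothesis becomes the conjugated one of
    [cle_of_conj_cnorm]. *)
Lemma cle_of_homogeneous (p q : H -> A) (C : R) :
  (forall c x, p (c *: x) = c * p x * star c) ->
  (forall c x, q (c *: x) = c * q x * star c) ->
  (forall x, cpos (p x)) -> (forall x, cpos (q x)) -> 0 <= C ->
  (forall x, cnorm (p x) <= C * cnorm (q x)) ->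
  forall x, cle (p x) (C%:C *: q x).
Proof.
move=> pZ qZ pp pq C0 le x; have [sp _] := pp x.
apply: cle_of_conj_cnorm => // h sh.
by have := le (h *: x); rewrite pZ qZ sh.
Qed.

Lemma frame_sum_homogeneous (T : nat -> adjointable H) (s : H -> A) :
  (forall x, frame_sum J T x (s x)) ->
  forall c x, s (c *: x) = c * s x * star c.
Proof.
move=> hs c x; apply: ccvg_unique (hs _) _.
exact: (frame_sumZ (fun i => adjointableZ (T i) c x) (hs x)).
Qed.

Lemma frame_cnorm_bounds K (T : nat -> adjointable H) (a b : R) (s : H -> A) :
  frame_bounds K J T a b -> (forall x, frame_sum J T x (s x)) ->
  forall x, a * cnorm (dot (adj K x) (adj K x)) <= cnorm (s x) /\
            cnorm (s x) <= b * cnorm (dot x x).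
Proof.
move=> [a0 b0 hT] hs x; have [s' [s's lo up]] := hT x.
have es := ccvg_unique s's (hs x); rewrite {}es in lo up.
have := cle_cnorm _ lo; have := cle_cnorm (frame_sum_pos (hs x)) up.
rewrite !cnormZr (ger0_norm (ltW a0)) (ger0_norm (ltW b0)) => up' lo'; split=> //.
by apply: lo'; apply: cposZ (dot_ge0 _); apply: ltW.
Qed.

Lemma frame_bounds_of_cnorm K (T : nat -> adjointable H) (a b : R) (s : H -> A) :
  0 < a -> 0 < b -> (forall x, frame_sum J T x (s x)) ->
  (forall x, a * cnorm (dot (adj K x) (adj K x)) <= cnorm (s x)) ->
  (forall x, cnorm (s x) <= b * cnorm (dot x x)) ->
  frame_bounds K J T a b.
Proof.
move=> a0 b0 hs lo up; split=> // x; exists (s x).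
have sZ := frame_sum_homogeneous hs.
have sp y := frame_sum_pos (hs y).
split=> //.
  (* The comparison lemma carries its constant on the larger side, so the lower bound is proved with
     a^-1 and then multiplied by a. *)
  have h := @cle_of_homogeneous (fun y => dot (adj K y) (adj K y)) s a^-1.
  have {}h : cle (dot (adj K x) (adj K x)) (a^-1%:C *: s x).
    apply: h => //; first by move=> c y; rewrite adjZ dotZZ.
    - by move=> y; apply: dot_ge0.
    - by rewrite invr_ge0 ltW.
    - by move=> y; rewrite ler_pdivlMl.
  have := cposZ (ltW a0) h; rewrite scalerBr scalerA -rmorphM mulfV ?lt0r_neq0 //.
  by rewrite scale1r.
apply: (@cle_of_homogeneous s (fun y => dot y y)) => //.
- by move=> c y; rewrite dotZZ.
- by move=> y; apply: dot_ge0.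
- exact: ltW.
Qed.

End FrameSums.

Theorem theorem5p4 (R : realType) (A : cstarAlgType R) (H : hilbertModType A)
    (K : adjointable H) (J : set nat) (T S : nat -> adjointable H) (a b : R)
    (hT : frame_bounds K J T a b) :
  ((exists2 M : R, 0 < M & close_frames J T S M) -> is_frame K J S) /\
  (coisometry K -> is_frame K J S ->
     exists2 M : R, 0 < M & close_frames J T S M).
Proof.
have [a0 b0 _] := hT.
have [t ht] : {t : H -> A & forall x, frame_sum J T x (t x)}.
  by apply: choice => x; case: hT => _ _ /(_ x)[s [? _ _]]; exists s.
have bt := frame_cnorm_bounds hT ht.
split.
  move=> [M M0 close].
  have [s hs] : {s : H -> A & forall x, frame_sum J S x (s x)}.
    by apply: choice => x; case: (close x) => [_ [_ [s [_ _ ? _]]]]; exists s.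
  have hd x : exists2 d, frame_sum J (fun i y => T i y - S i y) x d &
      cnorm d <= M * Num.min (cnorm (t x)) (cnorm (s x)).
    case: (close x) => [d [t' [s' [hd ht' hs' le]]]]; exists d => //.
    by rewrite (ccvg_unique (ht x) ht') (ccvg_unique (hs x) hs').
  (* With t, s, d the sums for T, S, T - S: |t| <= 2 (|d| + |s|) <= 2 (1 + M) |s| gives the lower
     bound, |s| <= 2 (|t| + |d|) <= 2 (1 + M) |t| the upper one. *)
  exists (a / (2 * (1 + M))), (2 * (1 + M) * b).
  have C0 : 0 < 2 * (1 + M) by lra.
  apply: (frame_bounds_of_cnorm (s := s)) => //; first exact: divr_gt0.
  - exact: mulr_gt0.
  - move=> x; have [d hdx le] := hd x.
    (* T is written as the difference of T - S and -S, the form that [cnorm_frame_sum_sub]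
       accepts. *)
    have h : frame_sum J (fun i y => (T i y - S i y) - - S i y) x (t x).
      by have := ht x; congr (norm_cvg _ _ _); apply: funext => n;
         apply: eq_bigr => i _; rewrite opprK subrK.
    have hN : frame_sum J (fun i y => - S i y) x (s x).
      by have := hs x; congr (norm_cvg _ _ _); apply: funext => n;
         apply: eq_bigr => i _; rewrite dotNl dotNr opprK.
    have := cnorm_frame_sum_sub hdx hN h.
    have [lo _] := bt x.
    have : M * Num.min (cnorm (t x)) (cnorm (s x)) <= M * cnorm (s x).
      by rewrite ler_wpM2l ?(ltW M0) // ge_min lexx orbT.
    rewrite mulrAC ler_pdivrMr //; nra.
  - move=> x; have [d hdx le] := hd x.
    have h : frame_sum J (fun i y => T i y - (T i y - S i y)) x (s x).
      by have := hs x; congr (norm_cvg _ _ _); apply: funext => n;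
         apply: eq_bigr => i _; rewrite subKr.
    have := cnorm_frame_sum_sub (ht x) hdx h.
    have [_ up] := bt x.
    have : M * Num.min (cnorm (t x)) (cnorm (s x)) <= M * cnorm (t x).
      by rewrite ler_wpM2l ?(ltW M0) // ge_min lexx.
    have : (1 + M) * cnorm (t x) <= (1 + M) * (b * cnorm (dot x x)).
      by rewrite ler_wpM2l //; lra.
    lra.
move=> iso [a' [b' hS]]; have [a'0 b'0 _] := hS.
have [s hs] : {s : H -> A & forall x, frame_sum J S x (s x)}.
  by apply: choice => x; case: hS => _ _ /(_ x)[s [? _ _]]; exists s.
have bs := frame_cnorm_bounds hS hs.
(* The co-isometry turns both lower bounds into multiples of |[dot x x]|, so each sum dominates the
   other up to a constant. *)
have kk x : cnorm (dot (adj K x) (adj K x)) = cnorm (dot x x).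
  by rewrite -!hnorm_sqr iso.
(* Here |s| <= (b' / a) |t| and |t| <= (b / a') |s|; adding both ratios covers either value of the
   minimum in |d| <= 2 (|t| + |s|). *)
exists (2 * (1 + b' / a + b / a')).
  by rewrite mulr_gt0 // !addr_gt0 // divr_gt0.
move=> x; have [d hd] := frame_sum_sub_exists (ht x) (hs x).
exists d, (t x), (s x); split=> //.
have := cnorm_frame_sum_sub (ht x) (hs x) hd.
have [] := bt x; have [] := bs x; rewrite kk => lo' up' lo up.
have s0 := cnorm_ge0 (s x); have t0 := cnorm_ge0 (t x).
have h1 : cnorm (s x) <= b' / a * cnorm (t x).
  by apply: le_trans up' _; rewrite -mulrA ler_pM2l // ler_pdivlMl.
have h2 : cnorm (t x) <= b / a' * cnorm (s x).
  by apply: le_trans up _; rewrite -mulrA ler_pM2l // ler_pdivlMl.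
have q1 : 0 <= b' / a by rewrite divr_ge0 ?ltW.
have q2 : 0 <= b / a' by rewrite divr_ge0 ?ltW.
by case: (leP (cnorm (t x)) (cnorm (s x))) => _; nra.
Qed.
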